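(* $$d_{\rm BM}\big(C([0,\omega]\times 3),\,C[0,\omega]\big)\ \ge\ 3.53125 .$$
   Context: $C(K)$ is the Banach space of real-valued continuous functions on the compact space $K$ with the supremum norm. $[0,\omega]$ is the ordinal interval $\omega+1$ with the order topology, i.e. a convergent sequence together with its limit; $C[0,\omega]$ denotes $C([0,\omega])$. Here $3=\{0,1,2\}$ is discrete, so $[0,\omega]\times 3$ is the disjoint union of three copies of $[0,\omega]$. For isomorphic Banach spaces $X,Y$, $d_{\rm BM}(X,Y)=\inf\{\|T\|\cdot\|T^{-1}\| : T:X\to Y \text{ an isomorphism}\}$, where an isomorphism is a bounded linear bijection (with bounded inverse). *)

(* Defs.v *)
From HB Require Import structures.
From mathcomp Require Import all_boot all_order all_algebra.
From mathcomp Require Import all_classical all_reals all_analysis.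
From mathcomp Require Import ring lra.

Set Implicit Arguments.
Unset Strict Implicit.
Unset Printing Implicit Defensive.

Import Order.TTheory GRing.Theory Num.Theory.
Import numFieldNormedType.Exports.

Local Open Scope classical_set_scope.
Local Open Scope ring_scope.

HB.mixin Record isCompactSpace T & Topological T := {
  compact_setT : compact [set: T]
}.

#[short(type="compactType")]
HB.structure Definition CompactSpace :=
  {T of Topological T & isCompactSpace T}.

Lemma prod_compact_setT (K L : compactType) : compact [set: K * L].
Proof. by rewrite -setXTT; apply: compact_setX; exact: compact_setT. Qed.

HB.instance Definition _ (K L : compactType) :=
  isCompactSpace.Build (K * L)%type (@prod_compact_setT K L).

Lemma discrete_compact_setT (T : finType) : compact [set: discrete_topology T].
Proof. by apply: finite_compact; exact: (@finite_finset T [set: T]). Qed.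

HB.instance Definition _ (T : finType) :=
  isCompactSpace.Build (discrete_topology T) (@discrete_compact_setT T).

(* The ordinal omega + 1 = [0, omega], ordered with Omega on top and carrying
   the order topology. *)
Variant omega_succ := Fin of nat | Omega.

Definition option_of_omega_succ (x : omega_succ) : option nat :=
  if x is Fin n then Some n else None.

Definition omega_succ_of_option (x : option nat) : omega_succ :=
  if x is Some n then Fin n else Omega.

Lemma option_of_omega_succK :
  cancel option_of_omega_succ omega_succ_of_option.
Proof. by case. Qed.

HB.instance Definition _ := Countable.copy omega_succ
  (can_type option_of_omega_succK).

Definition omega_succ_le (x y : omega_succ) : bool :=
  match x, y with
  | _, Omega => true
  | Omega, Fin _ => false
  | Fin m, Fin n => (m <= n)%N
  end.

Definition omega_succ_lt (x y : omega_succ) : bool :=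
  (y != x) && omega_succ_le x y.

Definition omega_succ_meet (x y : omega_succ) : omega_succ :=
  if omega_succ_lt x y then x else y.

Definition omega_succ_join (x y : omega_succ) : omega_succ :=
  if omega_succ_lt x y then y else x.

Lemma omega_succ_le_anti : antisymmetric omega_succ_le.
Proof. by move=> [m|] [n|] //= /anti_leq ->. Qed.

Lemma omega_succ_le_trans : transitive omega_succ_le.
Proof. by move=> [n|] [m|] [p|] //=; exact: leq_trans. Qed.

Lemma omega_succ_le_total : total omega_succ_le.
Proof. by move=> [m|] [n|] //=; exact: leq_total. Qed.

Fact omega_succ_display : Order.disp_t. Proof. exact: (Order.Disp tt tt). Qed.

HB.instance Definition _ := Order.isOrder.Build omega_succ_display omega_succ
  (fun _ _ => erefl) (fun _ _ => erefl) (fun _ _ => erefl)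
  omega_succ_le_anti omega_succ_le_trans omega_succ_le_total.

HB.instance Definition _ :=
  OrderTopological.copy omega_succ (order_topology omega_succ).

Lemma nbhs_Omega (U : set omega_succ) :
  nbhs Omega U -> exists n, forall m, (n < m)%N -> U (Fin m).
Proof.
rewrite itv_nbhsE => -[[a b] [/= ab Oab] abU].
case: b ab Oab abU => [bb x|bb] ab Oab abU.
  move: Oab; rewrite itv_boundlr /= => /andP[_].
  by rewrite (itv_open_ends_rside ab) bnd_simp; case: x {ab abU}.
rewrite (itv_open_ends_rinfty ab) in Oab abU.
case: a ab Oab abU => [aa x|aa] ab Oab abU.
  rewrite (itv_open_ends_lside ab) in Oab abU.
  case: x ab Oab abU => [n|] ab Oab abU; last first.
    by move: Oab; rewrite in_itv.
  exists n => m nm; apply: abU; rewrite /= in_itv /= andbT.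
  have -> : (Fin n < Fin m)%O = omega_succ_lt (Fin n) (Fin m) by [].
  rewrite /omega_succ_lt /= (ltnW nm) andbT.
  by apply/eqP => -[mn]; rewrite mn ltnn in nm.
rewrite (itv_open_ends_linfty ab) in abU.
by exists 0%N => m _; apply: abU; rewrite /= in_itv.
Qed.

Lemma omega_succ_compact_setT : compact [set: omega_succ].
Proof.
move=> F FF _; apply: contrapT => FN0.
have /existsNP[A /existsNP[B /not_implyP[FA /not_implyP[nB AB]]]] :
  ~ cluster F Omega by move=> FO; apply: FN0; exists Omega.
have [n nU] := nbhs_Omega nB.
have AC : A `<=` Fin @` `I_n.+1.
  move=> [m|] Am; last by case: AB; exists Omega; split => //; exact: nbhs_singleton.
  exists m => //=; rewrite ltnNge; apply/negP => nm.
  by apply: AB; exists (Fin m); split => //; exact: nU.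
have : compact (Fin @` `I_n.+1) by exact/finite_compact/finite_image.
move=> /(_ F FF (filterS AC FA))[x [_ Fx]].
by apply: FN0; exists x.
Qed.

HB.instance Definition _ :=
  isCompactSpace.Build omega_succ omega_succ_compact_setT.

Definition continuous_space (R : realType) (K : compactType) : Type :=
  continuousType K R.

HB.instance Definition _ (R : realType) (K : compactType) :=
  Choice.copy (continuous_space R K) (continuousType K R).

Section continuous_space_lmodule.
Variables (R : realType) (K : compactType).
Implicit Types (f g h : continuous_space R K) (a b : R).

Lemma cts_opp_continuous f : continuous (fun x => - f x).
Proof. by move=> x; apply: continuousN; exact: cts_fun. Qed.

Lemma cts_add_continuous f g : continuous (fun x => f x + g x).
Proof. by move=> x; apply: continuousD; exact: cts_fun. Qed.

Lemma cts_scale_continuous a f : continuous (fun x => a * f x).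
Proof.
by move=> x; apply: continuousM; [exact: cst_continuous|exact: cts_fun].
Qed.

Definition cts_zero : continuous_space R K :=
  mkcts (@cst_continuous K R 0).
Definition cts_opp f : continuous_space R K := mkcts (@cts_opp_continuous f).
Definition cts_add f g : continuous_space R K :=
  mkcts (@cts_add_continuous f g).
Definition cts_scale a f : continuous_space R K :=
  mkcts (@cts_scale_continuous a f).

Lemma cts_eqP f g : f =1 g -> f = g.
Proof. by move=> fg; exact/continuousEP. Qed.

Lemma cts_addA : associative cts_add.
Proof. by move=> f g h; apply: cts_eqP => x; exact: addrA. Qed.
Lemma cts_addC : commutative cts_add.
Proof. by move=> f g; apply: cts_eqP => x; exact: addrC. Qed.
Lemma cts_add0 : left_id cts_zero cts_add.
Proof. by move=> f; apply: cts_eqP => x; exact: add0r. Qed.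
Lemma cts_addN : left_inverse cts_zero cts_opp cts_add.
Proof. by move=> f; apply: cts_eqP => x; exact: addNr. Qed.

HB.instance Definition _ := GRing.isZmodule.Build (continuous_space R K)
  cts_addA cts_addC cts_add0 cts_addN.

Lemma cts_scaleA a b f : cts_scale a (cts_scale b f) = cts_scale (a * b) f.
Proof. by apply: cts_eqP => x; exact: mulrA. Qed.
Lemma cts_scale1 : left_id 1 cts_scale.
Proof. by move=> f; apply: cts_eqP => x; exact: mul1r. Qed.
Lemma cts_scaleDr : right_distributive cts_scale +%R.
Proof. by move=> a f g; apply: cts_eqP => x; exact: mulrDr. Qed.
Lemma cts_scaleDl f : {morph cts_scale^~ f : a b / a + b}.
Proof. by move=> a b; apply: cts_eqP => x; exact: mulrDl. Qed.

HB.instance Definition _ :=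
  GRing.Zmodule_isLmodule.Build R (continuous_space R K)
    cts_scaleA cts_scale1 cts_scaleDr cts_scaleDl.

Lemma cts_zeroE x : (0 : continuous_space R K) x = 0.
Proof. by []. Qed.
Lemma cts_oppE f x : (- f) x = - f x.
Proof. by []. Qed.
Lemma cts_addE f g x : (f + g) x = f x + g x.
Proof. by []. Qed.
Lemma cts_scaleE a f x : (a *: f) x = a * f x.
Proof. by []. Qed.

Definition sup_norm f : R := sup [set `|f x| | x in [set: K]].

Lemma cts_has_ubound f : has_ubound [set `|f x| | x in [set: K]].
Proof.
have : compact (f @` [set: K]).
  apply: continuous_compact compact_setT.
  exact/continuous_subspaceT/cts_fun.
move=> /compact_bounded[M [_ MB]]; exists (M + 1) => _ [x _ <-].
by apply: (MB (M + 1)); [rewrite ltrDl|exists x].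
Qed.

Lemma le_sup_norm f x : `|f x| <= sup_norm f.
Proof. by apply: ub_le_sup; [exact: cts_has_ubound|exists x]. Qed.

Lemma sup_norm_le f M : 0 <= M -> (forall x, `|f x| <= M) -> sup_norm f <= M.
Proof.
move=> M0 fM; rewrite /sup_norm.
have [->|N0] := eqVneq [set `|f x| | x in [set: K]] set0; first by rewrite sup0.
by apply: ge_sup; [exact/set0P|move=> _ [x _ <-]].
Qed.

Lemma sup_norm_ge0 f : 0 <= sup_norm f.
Proof.
rewrite /sup_norm.
have [->|/set0P[_ [x _ _]]] := eqVneq [set `|f x| | x in [set: K]] set0.
  by rewrite sup0.
exact: le_trans (normr_ge0 (f x)) (le_sup_norm f x).
Qed.

Lemma ler_sup_normD f g : sup_norm (f + g) <= sup_norm f + sup_norm g.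
Proof.
apply: sup_norm_le => [|x]; first by rewrite addr_ge0// sup_norm_ge0.
by rewrite (le_trans (ler_normD _ _))// lerD// le_sup_norm.
Qed.

Lemma sup_normZ_le a f : sup_norm (a *: f) <= `|a| * sup_norm f.
Proof.
apply: sup_norm_le => [|x]; first by rewrite mulr_ge0// sup_norm_ge0.
by rewrite cts_scaleE normrM ler_wpM2l// le_sup_norm.
Qed.

Lemma sup_normZ a f : sup_norm (a *: f) = `|a| * sup_norm f.
Proof.
apply/eqP; rewrite eq_le sup_normZ_le/=.
have [->|a0] := eqVneq a 0; first by rewrite normr0 mul0r sup_norm_ge0.
rewrite -ler_pdivlMl ?normr_gt0// -normfV.
by rewrite -[X in sup_norm X](scalerK a0) sup_normZ_le.
Qed.

Lemma sup_norm0_eq0 f : sup_norm f = 0 -> f = 0.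
Proof.
move=> f0; apply: cts_eqP => x; apply/normr0_eq0/eqP.
by rewrite eq_le normr_ge0 andbT -f0 le_sup_norm.
Qed.

HB.instance Definition _ := Lmodule_isNormed.Build R (continuous_space R K)
  ler_sup_normD sup_normZ sup_norm0_eq0.

Lemma cts_normE f : `|f| = sup [set `|f x| | x in [set: K]].
Proof. by []. Qed.

End continuous_space_lmodule.

Section continuous_space_complete.
Variables (R : realType) (K : compactType).
Local Notation CK := (continuous_space R K).

Lemma cts_ballP (f g : CK) (e : R) :
  0 < e -> (forall x, `|f x - g x| <= e / 2) -> ball f e g.
Proof.
move=> e0 fg; rewrite -ball_normE /= (@le_lt_trans _ _ (e / 2))//.
  by apply: sup_norm_le => //; rewrite divr_ge0// ltW.
by rewrite ltr_pdivrMr// ltr_pMr// ltr1n.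
Qed.

Lemma cts_ball_eval (f g : CK) (e : R) (x : K) :
  ball f e g -> `|f x - g x| < e.
Proof.
rewrite -ball_normE /= => fg; exact: le_lt_trans (le_sup_norm (f - g) x) fg.
Qed.

Lemma cts_cauchy_cvg (F : set_system CK) :
  ProperFilter F -> cauchy F -> cvg F.
Proof.
move=> FF /cauchyP Fc.
have cx x : cvg ((fun f : CK => f x) @ F).
  apply: cauchy_cvg; apply: cauchy_exP => e e0.
  have [f Ff] := Fc _ e0; exists (f x).
  apply: (@filterS _ F _ (ball f e) _ _ Ff) => g fg.
  exact: (cts_ball_eval x fg).
pose l x : R := lim ((fun f : CK => f x) @ F).
have Fl e : 0 < e -> F [set f : CK | forall x, `|l x - f x| <= e].
  move=> e0; have [f Ff] := Fc _ (divr_gt0 e0 (ltr0Sn R 1)).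
  apply: (@filterS _ F _ (ball f (e / 2)) _ _ Ff) => g fg x.
  have lf : `|l x - f x| <= e / 2.
    apply/ler_addgt0Pr => d d0.
    have lF : F [set h : CK | `|l x - h x| < d].
      by have /cvgrPdist_lt := cx x; apply.
    have [h [/= lh fh]] := filter_ex (filterI lF Ff).
    rewrite (le_trans (ler_distD (h x) _ _))// addrC lerD ?(ltW lh)//.
    by rewrite distrC; apply/ltW/(cts_ball_eval x fh).
  rewrite (le_trans (ler_distD (f x) _ _))// [leRHS]splitr lerD//.
  exact/ltW/(cts_ball_eval x fg).
have lc : continuous l.
  move=> x; apply/cvgrPdist_lt => e e0.
  have e3 : 0 < e / 3 by rewrite divr_gt0.
  have [f lf] := filter_ex (Fl _ e3).
  have /cvgrPdist_lt/(_ _ e3) fc := @cts_fun _ _ f x.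
  near=> y.
  have -> : l x - l y = (l x - f x) + (f x - f y) - (l y - f y) by ring.
  have -> : e = e / 3 + e / 3 + e / 3 by field.
  rewrite (le_lt_trans (ler_normB _ _))// ltr_leD//.
  rewrite (le_lt_trans (ler_normD _ _))// ler_ltD//.
  by near: y.
apply/cvg_ex; exists (mkcts lc : CK); apply/cvg_ballP => e e0.
have := Fl _ (divr_gt0 e0 (ltr0Sn R 1)); apply: filterS => f lf.
exact: cts_ballP.
Unshelve. all: by end_near. Qed.

HB.instance Definition _ := Uniform_isComplete.Build CK cts_cauchy_cvg.

End continuous_space_complete.

Section Banach_Mazur.
Variables (R : realType) (X Y : completeNormedModType R).

Definition operator_norm (V W : normedModType R) (T : V -> W) : R :=
  sup [set `|T x| | x in [set x : V | `|x| <= 1]].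

(* For a linear map, bounded_near at 0 is boundedness of the operator
   (linear_boundedP). An isomorphism T is given together with its inverse S. *)
Definition inverse_isomorphisms (T : {linear X -> Y})
    (S : {linear Y -> X}) : Prop :=
  [/\ cancel T S, cancel S T,
      bounded_near T (nbhs 0) & bounded_near S (nbhs 0)].

(* The infimum is taken in R, where inf set0 = 0: a positive lower bound on the
   distance entails that X and Y are isomorphic. *)
Definition banach_mazur_distance : R :=
  inf [set d | exists (T : {linear X -> Y}) (S : {linear Y -> X}),
    inverse_isomorphisms T S /\
    d = operator_norm T * operator_norm S].

End Banach_Mazur.

Arguments banach_mazur_distance {R} X Y.

(* Main.v *)
Require Import Defs.
From HB Require Import structures.
From mathcomp Require Import all_boot all_order all_algebra.
From mathcomp Require Import all_classical all_reals all_analysis.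
From mathcomp Require Import ring lra.
Import Order.TTheory GRing.Theory Num.Theory.
Import numFieldNormedType.Exports.
Local Open Scope ring_scope.

(** Why the distance is at least 113/32.

    Let T : C([0,omega] x 3) -> C[0,omega] be an isomorphism with inverse S,
    scaled so that |S| <= 1, and let D bound |T|.  Each functional
    f |-> T f x is a signed distribution of mass, of total variation at most D,
    on the points of [0,omega] x 3, and each functional y |-> S y p is one, of
    total variation at most 1, on the points of [0,omega].  Write c_j for the
    mass that T puts near the limit point of the copy j when evaluated at
    omega, s for the variation of the rest of that functional, d_i for the
    mass that S puts near omega when evaluated at the limit point of the
    copy i, and K_i for the sum of the |c_j| with j <> i.  Up to an error that
    can be made as small as desired:

    - s + sum_j |c_j| <= D, by the bound on T (mass_le);
    - 1 <= s + sum_j c_j d_j, because T S 1 = 1 at omega (pairing_ge);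
    - writing S T as the identity on step functions shows that S, evaluated at
      the limit point i, must put variation at least
      t_i = (1 - c_i d_i + |d_i| K_i) / D on a finite initial segment, so
      t_i + |d_i| <= 1 (limit_constraint);
    - the spike at a late isolated point of the copy i is sent by T to a
      function v that is small on that initial segment, and beyond it
      |2 v - c_i| <= E_i = D - s - K_i, for the other masses of T are fixed
      and only the mass c_i can be split between the spike and the rest of
      the copy.  Applying S must give back the value 1 at the spike, with only
      the variation 1 - t_i available beyond the segment; hence
      2 - c_i d_i <= (1 - t_i) E_i (spike_constraint).

    Replacing c_i and d_i by their absolute values only helps, and what is
    left is a system of inequalities in seven nonnegative reals.  It has no
    solution for D = 113/32 (profile_lt): for the copy with the smallest |c_i|
    the last constraint forces s plus the two larger |c_j| to be at most
    0.91, while the third one keeps the |d_j| so small that then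
    s + sum_j |c_j| |d_j| < 1.  There is enough room for a positive error, so
    that no passage to a limit is needed.

    All masses are handled through test functions: step functions supported on
    tails of the copies, spikes, and a finitely supported function that nearly
    realises s.

    As the infimum of the empty set is 0, an isomorphism has to be exhibited
    as well (exists_isomorphism): the three copies are interlaced after their
    limits have been shifted to a common value, and two initial coordinates
    keep the limits that this loses. *)

Set Implicit Arguments.
Unset Strict Implicit.
Unset Printing Implicit Defensive.

Local Open Scope classical_set_scope.

Local Notation index := (discrete_topology 'I_3).
Local Notation three := (omega_succ * index)%type.

(** * The incompatible inequalities *)

(** With y = a3 * A3 and k = s + A1 + A2, the last hypothesis gives
    D * (2 - y) <= (D - 1 - y) * (D - k) up to the error, since
    A1 + A2 >= 2 * A3.  As y <= A3 <= k / 2, this is a quadratic inequality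
    in k; its smaller root is just above 0.90 and its larger one exceeds
    D + e, whence k <= 0.91.  The other hypotheses give a_i <= (D - 1) / D,
    about 0.717, except for a1 when A1 > A2 + A3; there a1 exceeds this
    value by at most (A1 - A2 - A3) / D, which leaves the sum below 1 since
    A3 <= A2. *)
Lemma sorted_profile_lt (R : realType) (s A1 A2 A3 a1 a2 a3 : R) :
  let D : R := 113 / 32 in let e : R := 1 / 1000 in
  0 <= s -> 0 <= A3 <= A2 -> A2 <= A1 ->
  0 <= a1 <= 1 -> 0 <= a2 <= 1 -> 0 <= a3 <= 1 ->
  s + A1 + A2 <= D + e ->
  1 - a1 * A1 + a1 * (A2 + A3) + D * a1 <= D + e ->
  1 - a2 * A2 + a2 * (A1 + A3) + D * a2 <= D + e ->
  1 - a3 * A3 + a3 * (A1 + A2) + D * a3 <= D + e ->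
  (1 - a3 * A3 + a3 * (A1 + A2)) * (D - s - (A1 + A2)) + D * (2 - a3 * A3) <=
    D * (D - s - (A1 + A2)) + D * e ->
  s + a1 * A1 + a2 * A2 + a3 * A3 < 1 - e.
Proof.
move=> D e s0 /andP[A30 A32] A21 /andP[a10 a11] /andP[a20 a21] /andP[a30 a31].
move=> kD b1 b2 b3 c3.
have DE : D = 113 / 32 by [].
have eE : e = 1 / 1000 by [].
clearbody D e.
set k := s + A1 + A2 in kD *.
have k_le : k <= 91 / 100.
  pose y := a3 * A3.
  have y0 : 0 <= y by rewrite /y mulr_ge0.
  have yk : y <= k / 2.
    have : y <= A3 by rewrite /y ler_piMl.
    by rewrite /k; lra.
  have q1 : (D - 1 - y) * (D - k) - D * (2 - y) >= - (D * e) - 4 * e.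
    have gap0 : 0 <= a3 * (A1 + A2 - 2 * A3) by rewrite mulr_ge0//; lra.
    have gap4 : a3 * (A1 + A2 - 2 * A3) <= 4.
      have : a3 * (A1 + A2 - 2 * A3) <= 1 * (A1 + A2 - 2 * A3).
        by rewrite ler_wpM2r//; lra.
      by subst D e; rewrite /k in kD; lra.
    have kD' : 0 <= D - k + e by lra.
    move: (mulr_ge0 gap0 kD') c3.
    have -> : a3 * (A1 + A2) = a3 * (A1 + A2 - 2 * A3) + 2 * y.
      by rewrite /y; ring.
    rewrite -/y; clearbody y.
    move: (a3 * (A1 + A2 - 2 * A3)) gap0 gap4 => P P0 P4.
    by rewrite /k; subst D e; lra.
  rewrite leNgt; apply/negP => kk.
  by subst D e; nra.
have a3D : a3 * D <= D - 1 + e.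
  have : 0 <= a3 * (A1 + A2 - A3) by rewrite mulr_ge0//; lra.
  by lra.
have a2D : a2 * D <= D - 1 + e.
  have : 0 <= a2 * (A1 + A3 - A2) by rewrite mulr_ge0//; lra.
  by lra.
(* 718/1000 bounds (D - 1 + e) / D, and 10/35 bounds 1 / D. *)
have p2 : a2 * A2 <= 718/1000 * A2 by rewrite ler_wpM2r//; subst D e; lra.
have p3 : a3 * A3 <= 718/1000 * A3 by rewrite ler_wpM2r//; subst D e; lra.
have [le|gt] := leP A1 (A2 + A3).
  have p1 : a1 * A1 <= 718/1000 * A1.
    rewrite ler_wpM2r//; first lra.
    have : 0 <= a1 * (A2 + A3 - A1) by rewrite mulr_ge0//; lra.
    by subst D e; lra.
  subst D e; rewrite /k in k_le; lra.
have a1D : a1 * D <= D - 1 + e + (A1 - A2 - A3).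
  have : 0 <= (1 - a1) * (A1 - A2 - A3) by rewrite mulr_ge0//; lra.
  by lra.
have p1 : a1 * A1 <= (718/1000 + 10/35 * (A1 - A2 - A3)) * A1.
  rewrite ler_wpM2r//; [lra|subst D e; lra].
have A1k : A1 * (A1 - A2 - A3) <= 91 / 100 * (A1 - A2 - A3).
  by rewrite ler_wpM2r//; [lra|rewrite /k in k_le; lra].
by rewrite /k in k_le; subst D e; lra.
Qed.

Lemma profile_lt (R : realType) (s : R) (A a : 'I_3 -> R) :
  let D : R := 113 / 32 in let e : R := 1 / 1000 in
  let K i := \sum_j A j - A i in
  0 <= s -> (forall i, 0 <= A i) -> (forall i, 0 <= a i <= 1) ->
  s + \sum_j A j <= D + e ->
  (forall i, 1 - a i * A i + a i * K i + D * a i <= D + e) ->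
  (forall i, (1 - a i * A i + a i * K i) * (D - s - K i) + D * (2 - a i * A i)
     <= D * (D - s - K i) + D * e) ->
  s + \sum_j a j * A j < 1 - e.
Proof.
move=> D e K s0 A0 a01 sD b c.
pose o0 : 'I_3 := ord0; pose o1 : 'I_3 := lift ord0 ord0.
pose o2 : 'I_3 := ord_max.
have sum3 (F : 'I_3 -> R) : \sum_j F j = F o0 + F o1 + F o2.
  rewrite !big_ord_recl big_ord0 addr0 addrA.
  by congr (_ + F _); apply: val_inj.
move: sD b c; rewrite /K !sum3 => sD b c.
have sorted x y z : A x + A y + A z = A o0 + A o1 + A o2 ->
    A z <= A y -> A y <= A x -> s + a x * A x + a y * A y + a z * A z < 1 - e.
  move=> E zy yx; have := A0 z => z0.
  have {b c} bc i : _ := conj (b i) (c i).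
  move: (bc x) (bc y) (bc z); rewrite -E => -[bx _] [by_ _] [bz cz].
  apply: sorted_profile_lt => //; first exact/andP.
  - by move: sD; rewrite -/D -/e; lra.
  - have -> : A y + A z = A x + A y + A z - A x by ring.
    exact: bx.
  - have -> : A x + A z = A x + A y + A z - A y by ring.
    exact: by_.
  - have -> : A x + A y = A x + A y + A z - A z by ring.
    exact: bz.
  - have -> : A x + A y = A x + A y + A z - A z by ring.
    exact: cz.
case: (leP (A o0) (A o1)) => h01; case: (leP (A o1) (A o2)) => h12;
  case: (leP (A o0) (A o2)) => h02.
- by have := @sorted o2 o1 o0; lra.
- by have := @sorted o2 o1 o0; lra.
- by have := @sorted o1 o2 o0; lra.
- by have := @sorted o1 o0 o2; lra.
- by have := @sorted o2 o0 o1; lra.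
- by have := @sorted o0 o2 o1; lra.
- by have := @sorted o0 o1 o2; lra.
- by have := @sorted o0 o1 o2; lra.
Qed.

(** * Continuous functions on [0,omega] and on its three copies *)

Definition locally_constant (K : topologicalType) (V : Type) (f : K -> V) :=
  forall x, \forall y \near x, f y = f x.

Lemma locally_constant_continuous (K V : topologicalType) (f : K -> V) :
  locally_constant f -> continuous f.
Proof.
move=> lf x; apply: (near_cst_continuous (f x)).
exact: lf.
Qed.

Section splice.
Variables (R : realType) (K : compactType).
Implicit Types (P : K -> bool) (f g : continuous_space R K).

Lemma splice_continuous P f g : locally_constant P ->
  continuous (fun x => if P x then f x else g x).
Proof.
move=> lP x; case Px: (P x).
- rewrite /continuous_at Px; apply: cvg_trans (@cts_fun _ _ f x).
  by apply: near_eq_cvg; have := lP x; rewrite Px; apply: filterS => y ->.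
- rewrite /continuous_at Px; apply: cvg_trans (@cts_fun _ _ g x).
  by apply: near_eq_cvg; have := lP x; rewrite Px; apply: filterS => y ->.
Qed.

Definition splice P (lP : locally_constant P) f g : continuous_space R K :=
  mkcts (@splice_continuous P f g lP).

Lemma spliceE P (lP : locally_constant P) f g x :
  splice lP f g x = if P x then f x else g x.
Proof. by []. Qed.

Definition cts_cst (a : R) : continuous_space R K :=
  mkcts (@cst_continuous K R a).

Lemma norm_le_pointwise f (M : R) :
  0 <= M -> (forall x, `|f x| <= M) -> `|f| <= M.
Proof. exact: sup_norm_le. Qed.

Lemma le_norm_pointwise f x : `|f x| <= `|f|.
Proof. exact: le_sup_norm. Qed.
End splice.

Lemma nbhs_Fin n : nbhs (Fin n) [set Fin n].
Proof.
have lt x y : (Fin x < Fin y)%O = (x < y)%N.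
  have -> : (Fin x < Fin y)%O = omega_succ_lt (Fin x) (Fin y) by [].
  rewrite /omega_succ_lt /= ltn_neqAle; congr (_ && _).
  by rewrite eq_sym.
rewrite itv_nbhsE; case: n => [|n].
  exists `]-oo, Fin 1[%O; first by split; rewrite ?in_itv /= ?lt.
  move=> [m|] /=; rewrite in_itv /= ?lt //.
  by case: m.
exists `]Fin n, Fin n.+2[%O; first by split; rewrite ?in_itv /= ?lt ?ltnSn.
move=> [m|] /=; rewrite in_itv /= ?lt ?andbF //.
by move=> /andP[nm mn]; congr Fin; apply/eqP; rewrite eqn_leq nm andbT -ltnS.
Qed.

Lemma nbhs_Omega_Fin (A : set omega_succ) n :
  A Omega -> (forall m, (n <= m)%N -> A (Fin m)) -> nbhs Omega A.
Proof.
move=> AO Am; rewrite itv_nbhsE.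
exists `]Fin n, +oo[%O; first by split; rewrite ?in_itv.
move=> [m|] //=; rewrite in_itv /= andbT => lt.
apply: Am; have -> : (n <= m)%N = (Fin n <= Fin m)%O by [].
exact: ltW.
Qed.


Lemma locally_constant_omega_succ (V : Type) (f : omega_succ -> V) n :
  (forall m, (n <= m)%N -> f (Fin m) = f Omega) -> locally_constant f.
Proof.
move=> fn [m|]; last exact: (@nbhs_Omega_Fin _ n).
by apply: filterS (nbhs_Fin m) => _ ->.
Qed.

Lemma nbhs_copy (A : set three) (x : omega_succ) (i : index) :
  nbhs x [set y | A (y, i)] -> nbhs (x, i) A.
Proof.
move=> nA; exists ([set y | A (y, i)], [set i]) => /=.
  by split => //; exact: discrete_set1.
by move=> [y j] [/= Ay ->].
Qed.

Lemma locally_constant_three (V : Type) (f : three -> V) n :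
  (forall m i, (n <= m)%N -> f (Fin m, i) = f (Omega, i)) -> locally_constant f.
Proof.
move=> fn [x i]; apply: nbhs_copy.
apply: (@locally_constant_omega_succ _ (fun y => f (y, i)) n) => m nm.
exact: fn.
Qed.

Section limits.
Variable R : realType.

Lemma cts_omega_succ_cvg (f : continuous_space R omega_succ) (e : R) : 0 < e ->
  exists n, forall m, (n <= m)%N -> `|f Omega - f (Fin m)| < e.
Proof.
move=> e0; have /cvgrPdist_lt/(_ _ e0)/nbhs_Omega[n nf] := @cts_fun _ _ f Omega.
by exists n.+1.
Qed.

Lemma copy_continuous (i : index) : continuous (fun x : omega_succ => (x, i)).
Proof.
move=> x A /= [[B C] [/= nB nC] BCA]; apply: filterS nB => y By.
by apply: BCA; split => //=; exact: nbhs_singleton.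
Qed.

Lemma cts_three_cvg (f : continuous_space R three) (e : R) : 0 < e ->
  exists n, forall m i, (n <= m)%N -> `|f (Omega, i) - f (Fin m, i)| < e.
Proof.
move=> e0.
have c i : continuous (fun x : omega_succ => f (x, i)).
  move=> x; apply: (@continuous_comp _ _ _ (fun x => (x, i)) f).
    exact: copy_continuous.
  exact: cts_fun.
have /choice[n nP] i := cts_omega_succ_cvg (mkcts (c i)) e0.
exists (\max_(i : 'I_3) n i)%N => m i nm.
by apply: nP; apply: leq_trans nm; exact: leq_bigmax.
Qed.

Lemma continuous_dist (K : topologicalType) (f : K -> R) :
  (forall x e, 0 < e -> \forall y \near x, `|f x - f y| < e) -> continuous f.
Proof. by move=> fc x; apply/cvgrPdist_lt => e; exact: fc. Qed.

Lemma omega_succ_continuous (f : omega_succ -> R) :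
  (forall e, 0 < e ->
    exists n, forall m, (n <= m)%N -> `|f Omega - f (Fin m)| < e) ->
  continuous f.
Proof.
move=> fO; apply: continuous_dist => -[m|] e e0.
  by apply: filterS (nbhs_Fin m) => _ ->; rewrite subrr normr0.
have [n nf] := fO _ e0.
by apply: (@nbhs_Omega_Fin _ n) => //=; rewrite subrr normr0.
Qed.

Lemma three_continuous (f : three -> R) :
  (forall i, continuous (fun x : omega_succ => f (x, i))) -> continuous f.
Proof.
move=> fc; apply: continuous_dist => -[x i] e e0; apply: nbhs_copy.
by have /cvgrPdist_lt/(_ _ e0) := fc i x.
Qed.

End limits.

Definition tail (n : nat) (x : omega_succ) : bool :=
  if x is Fin m then (n <= m)%N else true.

Lemma tail_mono m n x : (m <= n)%N -> tail n x -> tail m x.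
Proof. by case: x => [k|//] /= mn; exact: leq_trans. Qed.

Lemma tail_locally_constant n : locally_constant (tail n).
Proof. by apply: (@locally_constant_omega_succ _ _ n) => m /= ->. Qed.

Lemma tail3_locally_constant n : locally_constant (fun p : three => tail n p.1).
Proof. by apply: (@locally_constant_three _ _ n) => m i /= ->. Qed.

Lemma point_locally_constant n (i : index) :
  locally_constant (fun p : three => p == (Fin n, i)).
Proof.
apply: (@locally_constant_three _ _ n.+1) => m j nm.
rewrite !xpair_eqE; have [mn|//] := eqVneq (Fin m) (Fin n).
by case: mn nm => ->; rewrite ltnn.
Qed.

Section test_functions.
Variable R : realType.
Local Notation X := (continuous_space R three).
Local Notation Y := (continuous_space R omega_succ).

Lemma levels_continuous (w : 'I_3 -> R) : continuous (fun p : three => w p.2).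
Proof.
apply: locally_constant_continuous.
exact: (@locally_constant_three _ _ 0).
Qed.

Definition levels (w : 'I_3 -> R) : X := mkcts (@levels_continuous w).

Definition step (n : nat) (w : 'I_3 -> R) : X :=
  splice (@tail3_locally_constant n) (levels w) 0.

Definition spike (n : nat) (i : index) : X :=
  splice (@point_locally_constant n i) (levels (fun=> 1)) 0.

Definition tail_indicator (n : nat) : Y :=
  splice (@tail_locally_constant n) (cts_cst _ 1) 0.

Lemma cts_sumE (K : compactType) (I : Type) (r : seq I) (P : pred I)
    (F : I -> continuous_space R K) x :
  (\sum_(i <- r | P i) F i) x = \sum_(i <- r | P i) F i x.
Proof. exact: (big_morph (fun f : continuous_space R K => f x)). Qed.

Lemma levelsE w p : levels w p = w p.2.
Proof. by []. Qed.

Lemma stepE n w p : step n w p = if tail n p.1 then w p.2 else 0.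
Proof. by []. Qed.

Lemma spikeE n i p : spike n i p = if p == (Fin n, i) then 1 else 0.
Proof. by []. Qed.

Lemma tail_indicatorE n x : tail_indicator n x = if tail n x then 1 else 0.
Proof. by []. Qed.

Definition delta (j : 'I_3) : 'I_3 -> R := fun i => (i == j)%:R.

Lemma step_sum n w : step n w = \sum_j w j *: step n (delta j).
Proof.
apply: cts_eqP => p; rewrite cts_sumE stepE; case: ifP => tp; last first.
  by rewrite big1// => j _; rewrite cts_scaleE stepE tp mulr0.
rewrite (bigD1 p.2) //= big1 => [|j jp]; rewrite cts_scaleE stepE tp /delta.
  by rewrite eqxx mulr1 addr0.
by rewrite eq_sym (negPf jp) mulr0.
Qed.

End test_functions.

Section operator.
Variable R : realType.
Local Notation X := (continuous_space R three).
Local Notation Y := (continuous_space R omega_succ).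
Variables (T : {linear X -> Y}) (D : R).
Hypothesis D0 : 0 <= D.
Hypothesis T_le : forall f, `|T f| <= D * `|f|.

Lemma T_pointwise (f : X) (r : R) x :
  0 <= r -> (forall p, `|f p| <= r) -> `|T f x| <= D * r.
Proof.
move=> r0 fr; apply: le_trans (le_norm_pointwise _ _) _.
by apply: le_trans (T_le f) _; rewrite ler_wpM2l//; exact: norm_le_pointwise.
Qed.

Lemma T_step n w x : T (step n w) x = \sum_j w j * T (step n (delta R j)) x.
Proof.
by rewrite step_sum linear_sum cts_sumE; apply: eq_bigr => j _; rewrite linearZ.
Qed.

(** Testing T against signed sums of spikes shows that the values at x of their
    images are absolutely summable. *)
Lemma spike_small i x (e : R) : 0 < e ->
  exists n0, forall n, (n0 <= n)%N -> `|T (spike R n i) x| <= e.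
Proof.
move=> e0; pose a n := T (spike R n i) x.
pose F n : X := \sum_(0 <= k < n) Num.sg (a k) *: spike R k i.
have FE n p : F n p = \sum_(0 <= k < n) Num.sg (a k) * spike R k i p.
  by rewrite cts_sumE.
have F1 n p : `|F n p| <= 1.
  rewrite FE; case: p => -[m|] j; last first.
    by rewrite big1 ?normr0// => k _; rewrite spikeE mulr0.
  have [->|ij] := eqVneq j i; last first.
    rewrite big1 ?normr0// => k _.
    by rewrite spikeE xpair_eqE (negPf ij) andbF mulr0.
  have [mn|nm] := ltnP m n; last first.
    rewrite big_nat big1 ?normr0// => k /andP[_ kn].
    rewrite spikeE; case: eqP; rewrite ?mulr0// => -[mk].
    by rewrite -mk ltnNge nm in kn.
  rewrite big_mkord (bigD1 (Ordinal mn)) //= big1 => [|k km].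
    by rewrite spikeE eqxx mulr1 addr0 normr_sg lern1; case: (a m != 0).
  rewrite spikeE; case: eqP; rewrite ?mulr0// => -[mk].
  by case/eqP: km; apply: val_inj.
have sum n : \sum_(0 <= k < n) `|a k| <= D.
  have -> : \sum_(0 <= k < n) `|a k| = T (F n) x.
    rewrite linear_sum cts_sumE; apply: eq_bigr => k _.
    by rewrite linearZ cts_scaleE -normrEsg.
  apply: le_trans (ler_norm _) _; rewrite -[D]mulr1.
  by apply: T_pointwise.
have : cvgn (series (fun n => `|a n|)).
  apply: nondecreasing_is_cvgn; first exact: nondecreasing_series.
  by exists D => _ [n _ <-]; exact: sum.
move/cvg_series_cvg_0/cvgrPdist_le/(_ _ e0) => -[n0 _ n0P].
by exists n0 => n /n0P /=; rewrite sub0r normrN normr_id.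
Qed.

(** The number s is the norm of f |-> T f Omega on finitely supported
    functions, that is, the mass that this functional puts on isolated
    points. *)
Lemma extremal (e : R) : 0 < e -> exists s (g : X) N,
  [/\ 0 <= s, forall p, `|g p| <= 1, forall p, tail N p.1 -> g p = 0,
      s - e < T g Omega &
      forall (f : X) n, (forall p, `|f p| <= 1) ->
        (forall p, tail n p.1 -> f p = 0) -> T f Omega <= s].
Proof.
move=> e0; pose A := [set r | exists (f : X) n, [/\ (forall p, `|f p| <= 1),
  (forall p, tail n p.1 -> f p = 0) & r = T f Omega]].
have A0 : A 0.
  by exists 0, 0%N; split => [p||]; rewrite ?cts_zeroE ?normr0 ?linear0.
have supA : has_sup A.
  split; first by exists 0.
  exists D => _ [f [n [f1 _ ->]]]; rewrite -[D]mulr1.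
  by apply: le_trans (ler_norm _) _; exact: T_pointwise.
have [_ [g [N [g1 g0 ->]]] gs] := sup_adherent e0 supA.
exists (sup A), g, N; split => //.
  by apply: ub_le_sup => //; exact: supA.2.
move=> f n f1 f0; apply: ub_le_sup; first exact: supA.2.
by exists f, n.
Qed.

End operator.

(** * The constraints on the limiting masses *)

(** The error e, the nearly extremal g and its support bound N come from the
    lemma extremal; M is a later stage, after which the images under T of g
    and of the unit steps from N on are within e of their limits. *)
Section stage.
Variable R : realType.
Local Notation X := (continuous_space R three).
Local Notation Y := (continuous_space R omega_succ).
Variables (T : {linear X -> Y}) (S : {linear Y -> X}) (D e s : R).
Hypotheses (TK : cancel T S) (SK : cancel S T) (D0 : 0 <= D) (e0 : 0 < e).
Hypothesis T_le : forall f, `|T f| <= D * `|f|.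
Hypothesis S_le : forall y, `|S y| <= `|y|.
Variables (g : X) (N M : nat).
Hypothesis g_le1 : forall p, `|g p| <= 1.
Hypothesis g_tail : forall p, tail N p.1 -> g p = 0.
Hypothesis g_near : s - e < T g Omega.
Hypothesis s_ub : forall (f : X) n, (forall p, `|f p| <= 1) ->
  (forall p, tail n p.1 -> f p = 0) -> T f Omega <= s.

Let c (j : 'I_3) := T (step N (delta R j)) Omega.
Let K (i : 'I_3) := \sum_j `|c j| - `|c i|.
Let z := tail_indicator R M.
Let b := S z.
Let d (j : 'I_3) := b (Omega, j).

Hypothesis M_step : forall x j, tail M x ->
  `|T (step N (delta R j)) x - c j| <= e.
Hypothesis M_g : forall x, tail M x -> `|T g x - T g Omega| <= e.

Lemma S_pointwise (y : Y) (r : R) p :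
  0 <= r -> (forall x, `|y x| <= r) -> `|S y p| <= r.
Proof.
move=> r0 yr; apply: le_trans (le_norm_pointwise _ _) _.
by apply: le_trans (S_le y) _; exact: norm_le_pointwise.
Qed.

Lemma b_le1 p : `|b p| <= 1.
Proof.
apply: S_pointwise => // x; rewrite tail_indicatorE.
by case: ifP; rewrite ?normr1 ?normr0.
Qed.

Lemma step_limit (w : 'I_3 -> R) x : (forall j, `|w j| <= 1) -> tail M x ->
  `|T (step N w) x - \sum_j w j * c j| <= 3 * e.
Proof.
move=> w1 Mx; rewrite T_step -sumrB.
have -> : 3 * e = \sum_(j < 3) e by rewrite sumr_const card_ord mulr_natl.
apply: le_trans (ler_norm_sum _ _ _) _; apply: ler_sum => j _.
rewrite -mulrBr normrM -[leRHS]mul1r.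
by apply: ler_pM => //; exact: M_step.
Qed.

(** g already realises s up to e, and adding to g a function supported beyond
    N does not increase the norm. *)
Lemma beyond_support (h : X) n (r : R) : 0 < r -> (forall p, `|h p| <= r) ->
  (forall p, ~~ tail N p.1 -> h p = 0) -> (forall p, tail n p.1 -> h p = 0) ->
  T h Omega <= r * e.
Proof.
move=> r0 hr hN hn.
have : T (g + r^-1 *: h) Omega <= s.
  apply: (@s_ub _ (maxn N n)) => p; rewrite cts_addE cts_scaleE.
    have [tp|tp] := boolP (tail N p.1); last by rewrite hN// mulr0 addr0.
    rewrite g_tail// add0r normrM gtr0_norm ?invr_gt0// mulrC.
    by rewrite ler_pdivrMr// mul1r.
  move=> tp; rewrite g_tail ?hn ?mulr0 ?addr0//.
    by apply: tail_mono tp; exact: leq_maxr.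
  by apply: tail_mono tp; exact: leq_maxl.
rewrite linearD linearZ cts_addE cts_scaleE.
move: g_near => gs le.
have : r^-1 * T h Omega <= e by lra.
by rewrite mulrC ler_pdivrMr// mulrC.
Qed.

Lemma mass_le : s + \sum_j `|c j| <= D + e.
Proof.
pose f : X := g + step N (fun j => Num.sg (c j)).
have : `|T f Omega| <= D * 1.
  apply: T_pointwise => // p; rewrite cts_addE stepE.
  case: ifP => tp; last by rewrite addr0.
  by rewrite g_tail// add0r normr_sg lern1; case: (c _ != 0).
rewrite linearD cts_addE T_step mulr1 => /ler_normlW.
under eq_bigr do rewrite -/(c _) -normrEsg.
by move: g_near; lra.
Qed.

(** The function b = S z is the sum of its part before N, where T contributes
    at most s, of the step with levels d, of a finitely supported part beyond
    N, and of a small remainder; and T b is 1 at Omega. *)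
Lemma pairing_ge : 1 - (2 + D) * e <= s + \sum_j c j * d j.
Proof.
have [n nP] := cts_three_cvg b e0.
have loc := @tail3_locally_constant.
pose fin : X := splice (loc N) 0 b.
pose diff : X := b - levels d.
pose h : X := splice (loc N) (splice (loc n) 0 diff) 0.
pose small : X := splice (loc N) (splice (loc n) diff 0) 0.
have bE : b = fin + step N d + h + small.
  apply: cts_eqP => p; rewrite !cts_addE stepE !spliceE !cts_zeroE.
  rewrite /diff cts_addE cts_oppE levelsE.
  by case: ifP => _; [case: ifP => _|]; ring.
have d1 i : `|d i| <= 1 by exact: b_le1.
have diff2 p : `|diff p| <= 2.
  rewrite cts_addE cts_oppE; apply: le_trans (ler_normB _ _) _.
  have := b_le1 p; have := d1 p.2; rewrite levelsE; lra.
have fin_le : T fin Omega <= s.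
  apply: (@s_ub _ N) => p; rewrite /fin spliceE.
    by case: ifP => _; rewrite ?cts_zeroE ?normr0// b_le1.
  by move=> ->.
have h_le : T h Omega <= 2 * e.
  apply: (@beyond_support _ n) => // p; rewrite /h !spliceE.
  - by case: ifP => _; [case: ifP => _|]; rewrite ?cts_zeroE ?normr0 ?ler0n.
  - by move/negPf ->.
  - by move=> ->; case: ifP.
have small_le : T small Omega <= D * e.
  apply: le_trans (ler_norm _) _.
  apply: T_pointwise => // [|p]; first exact: ltW.
  rewrite /small !spliceE; case: ifP => _; last by rewrite normr0 ltW.
  case: ifP => tp; last by rewrite normr0 ltW.
  rewrite /diff cts_addE cts_oppE levelsE.
  case: p tp => -[m|] i /= tp; last by rewrite subrr normr0 ltW.
  by rewrite distrC ltW// nP.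
have : T b Omega = 1 by rewrite /b SK.
rewrite {1}bE !linearD !cts_addE T_step.
under eq_bigr do rewrite -/(c _) mulrC.
lra.
Qed.

(** The image u of a signed step from N on is, beyond M, nearly the constant
    sigma; its part u0 before M is therefore sent by S to the step minus
    sigma * b, up to a small error. *)
Section signs.
Variable th : 'I_3 -> R.
Hypothesis th1 : forall j, `|th j| <= 1.
Let sigma := \sum_j th j * c j.
Let u := T (step N th).
Let u0 : Y := splice (@tail_locally_constant M) 0 u.

Lemma u_le x : `|u x| <= D.
Proof.
rewrite -[D]mulr1; apply: T_pointwise => // p; rewrite stepE.
by case: ifP => // _; rewrite normr0.
Qed.

Lemma sigma_le : `|sigma| <= D.
Proof.
have -> : sigma = u Omega by rewrite /u T_step.
exact: u_le.
Qed.

Lemma S_u0 p : `|S u0 p - (step N th p - sigma * b p)| <= 3 * e.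
Proof.
have -> : S u0 p - (step N th p - sigma * b p) = S (u0 - u + sigma *: z) p.
  rewrite (linearD S) (linearB S) (linearZ_LR S) /u TK -/b.
  rewrite !(cts_addE, cts_oppE, cts_scaleE); ring.
apply: S_pointwise => [|x]; first by rewrite mulr_ge0// ltW.
rewrite !(cts_addE, cts_oppE, cts_scaleE) spliceE tail_indicatorE.
case: ifP => Mx; last by rewrite mulr0 addr0 subrr normr0 mulr_ge0// ltW.
rewrite cts_zeroE add0r mulr1 addrC distrC.
exact: step_limit.
Qed.

(** u0 and D * z have disjoint supports, so that u0 + D * z and u0 - D * z
    still have norm at most D; S does not increase it. *)
Lemma limit_constraint i :
  th i - sigma * d i + D * `|d i| <= D + 3 * e.
Proof.
pose y : Y := u0 + (D * Num.sg (d i)) *: z.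
have : `|S y (Omega, i)| <= D.
  apply: S_pointwise => // x.
  rewrite !(cts_addE, cts_scaleE) spliceE tail_indicatorE.
  case: ifP => _; last by rewrite mulr0 addr0 u_le.
  rewrite cts_zeroE add0r mulr1 normrM ger0_norm// ler_piMr//.
  by rewrite normr_sg lern1; case: (d i != 0).
rewrite linearD linearZ cts_addE cts_scaleE -/b -mulrA -/(d i) -normrEsg.
move=> /ler_normlW; have := S_u0 (Omega, i); rewrite stepE /= -/(d i).
rewrite ler_norml => /andP[]; lra.
Qed.

(** Let v be the image of a late spike.  Beyond M, testing T against
    spike - (the rest of its copy), the signed steps of the other copies and g
    at once gives |2 v - c_i| <= E.  Hence E * u0 + D * (2 v1 - c_i z), where
    v1 is the part of v beyond M, has norm at most D * E; evaluating its image
    under S at the spike gives the inequality. *)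
Lemma spike_constraint i :
  let E := D - s - K i + 5 * e in
  0 <= E /\
  E * (th i - sigma * d i - (D + 3) * e) + D * (2 - c i * d i - (D + 2) * e)
    <= D * E.
Proof.
move=> E.
have [n [Nn bn small]] : exists n, [/\ (N <= n)%N, `|d i - b (Fin n, i)| <= e &
    forall x, ~~ tail M x -> `|T (spike R n i) x| <= e].
  have [n1 n1P] := cts_three_cvg b e0.
  have /choice[n2 n2P] (m : 'I_M) := spike_small D0 T_le i (Fin m) e0.
  pose n := maxn N (maxn n1 (\max_(m < M) n2 m)).
  exists n; split; first exact: leq_maxl.
    apply/ltW/n1P; apply: leq_trans (leq_maxl _ (\max_(m < M) n2 m)) _.
    exact: leq_maxr.
  move=> [m|//] /=; rewrite -ltnNge => mM.
  apply: (n2P (Ordinal mM)).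
  apply: leq_trans (leq_bigmax (Ordinal mM)) _.
  by apply: leq_trans (leq_maxr n1 _) _; exact: leq_maxr.
pose v := T (spike R n i).
have c_le : `|c i| <= D.
  rewrite -[D]mulr1; apply: T_pointwise => // p; rewrite stepE /delta.
  by case: ifP; rewrite ?normr0//; case: eqP; rewrite ?normr1 ?normr0.
have v_tail tau x : `|tau| = 1 -> tail M x -> tau * (2 * v x - c i) <= E.
  move=> tau1 Mx.
  pose w j := if j == i then - tau else Num.sg (c j).
  have w1 j : `|w j| <= 1.
    rewrite /w; case: eqP => _; first by rewrite normrN tau1.
    by rewrite normr_sg lern1; case: (c j != 0).
  pose f : X := g + step N w + (2 * tau) *: spike R n i.
  have : `|T f x| <= D * 1.
    apply: T_pointwise => // p.
    rewrite !(cts_addE, cts_scaleE) stepE spikeE.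
    have [->|pn] := eqVneq p (Fin n, i).
      rewrite g_tail //= Nn /w eqxx add0r.
      by rewrite mulr1 mulr2n mulrDl mul1r addKr tau1.
    rewrite mulr0 addr0; case: ifP => tp; last by rewrite addr0.
    by rewrite g_tail// add0r.
  rewrite !linearD linearZ !cts_addE cts_scaleE -/v mulr1 => /ler_normlW.
  have /andP[+ _] : - (3 * e) <= T (step N w) x - \sum_j w j * c j <= 3 * e.
    by rewrite -ler_norml step_limit.
  have /andP[+ _] : - e <= T g x - T g Omega <= e by rewrite -ler_norml M_g.
  have -> : \sum_j w j * c j = - tau * c i + K i.
    rewrite /K (bigD1 i) //= [X in _ = _ + (X - _)](bigD1 i) //=.
    rewrite /w eqxx [X in _ = _ + X]addrAC subrr add0r; congr (_ + _).
    by apply: eq_bigr => j /negPf ->; rewrite -normrEsg.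
  by move: g_near; rewrite /E; lra.
have v_abs x : tail M x -> `|2 * v x - c i| <= E.
  move=> Mx; rewrite ler_norml; apply/andP; split.
    by have := @v_tail (-1) x; rewrite normrN1 => /(_ erefl Mx); lra.
  by have := @v_tail 1 x; rewrite normr1 => /(_ erefl Mx); lra.
have E0 : 0 <= E by apply: le_trans (v_abs Omega _).
split => //.
pose v0 : Y := splice (@tail_locally_constant M) 0 v.
have Sv0 : `|S v0 (Fin n, i)| <= e.
  apply: S_pointwise => [|x]; first exact: ltW.
  rewrite spliceE; case: ifP => Mx; first by rewrite normr0 ltW.
  by rewrite small ?Mx.
pose y : Y := E *: u0 + D *: (2 *: (v - v0) - c i *: z).
have : `|S y (Fin n, i)| <= D * E.
  apply: S_pointwise => [|x]; first exact: mulr_ge0.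
  rewrite !(cts_addE, cts_oppE, cts_scaleE) tail_indicatorE !spliceE.
  case: ifP => Mx.
    rewrite !cts_zeroE mulr0 add0r subr0 mulr1 normrM (ger0_norm D0).
    by rewrite ler_wpM2l// v_abs.
  rewrite subrr !mulr0 subr0 mulr0 addr0 normrM (ger0_norm E0) mulrC.
  by rewrite ler_wpM2r// u_le.
rewrite (linearD S) 2!(linearZ_LR S) (linearB S) 2!(linearZ_LR S) (linearB S).
rewrite /v TK -/b.
rewrite !(cts_addE, cts_oppE, cts_scaleE) spikeE eqxx => /ler_normlW.
have := S_u0 (Fin n, i); rewrite stepE /= Nn ler_norml => /andP[Su _].
move: Sv0; rewrite ler_norml => /andP[_ Sv].
set bb := b _ in bn Su *; set su := S u0 _ in Su *; set sv := S v0 _ in Sv *.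
have p1 : `|sigma * (d i - bb)| <= D * e by rewrite normrM ler_pM// sigma_le.
have p2 : `|c i * (d i - bb)| <= D * e by rewrite normrM ler_pM.
move: p1 p2; rewrite !ler_norml => /andP[p1 p1'] /andP[p2 p2'] main.
have q1 : E * (th i - sigma * d i - (D + 3) * e) <= E * su.
  by rewrite ler_wpM2l//; lra.
have q2 : D * (2 - c i * d i - (D + 2) * e) <= D * (2 * (1 - sv) - c i * bb).
  by rewrite ler_wpM2l//; lra.
lra.
Qed.

End signs.

End stage.

(** * No isomorphism of small distortion *)

Section lower_bound.
Variable R : realType.
Local Notation X := (continuous_space R three).
Local Notation Y := (continuous_space R omega_succ).

(** Passing from the approximate spike constraint with x = c_i d_i to the one
    with y = |c_i d_i|. *)
Lemma absorb_error (E q x y : R) :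
  let D : R := 113 / 32 in let e : R := 1 / 1000 / 100 in
  0 <= q -> x <= y -> y <= D + e -> 0 <= E <= D + 5 * e ->
  E * (1 - (x - q) - (D + 3) * e) + D * (2 - x - (D + 2) * e) <= D * E ->
  (1 - y + q) * (E - 5 * e) + D * (2 - y)
    <= D * (E - 5 * e) + D * (1 / 1000).
Proof.
move=> D e q0 xy yD /andP[E0 ED] h.
have : 0 <= (E + D) * (y - x) by rewrite mulr_ge0//; rewrite /D; lra.
by move: yD ED h; rewrite /D /e; lra.
Qed.

Lemma no_close_isomorphism (T : {linear X -> Y}) (S : {linear Y -> X}) :
  cancel T S -> cancel S T ->
  (forall f, `|T f| <= 113 / 32 * `|f|) -> (forall y, `|S y| <= `|y|) -> False.
Proof.
move=> TK SK T_le S_le.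
(* Small enough for all errors to add up to less than 1 / 1000. *)
pose D : R := 113 / 32; pose e : R := 1 / 1000 / 100.
have D0 : 0 <= D by rewrite /D; lra.
have e0 : 0 < e by rewrite /e; lra.
have [s [g [N [s0 g1 g0 gs s_ub]]]] := extremal D0 T_le e0.
pose c (j : 'I_3) := T (step N (delta R j)) Omega.
have /choice[m mP] j := cts_omega_succ_cvg (T (step N (delta R j))) e0.
have [m' m'P] := cts_omega_succ_cvg (T g) e0.
pose M := maxn m' (\max_(j < 3) m j).
have M_step x j : tail M x -> `|T (step N (delta R j)) x - c j| <= e.
  case: x => [k|_]; last by rewrite subrr normr0 ltW.
  rewrite distrC => Mk; apply/ltW/mP; apply: leq_trans Mk.
  by apply: leq_trans (leq_bigmax j) _; exact: leq_maxr.
have M_g x : tail M x -> `|T g x - T g Omega| <= e.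
  case: x => [k|_]; last by rewrite subrr normr0 ltW.
  rewrite distrC => Mk; apply/ltW/m'P; apply: leq_trans Mk.
  exact: leq_maxl.
pose d (j : 'I_3) := S (tail_indicator R M) (Omega, j).
pose A j := `|c j|; pose a j := `|d j|.
pose K i := \sum_j A j - A i.
have KE i : K i = \sum_(j < 3 | j != i) A j.
  by rewrite /K (bigD1 i)//= addrAC subrr add0r.
have K0 i : 0 <= K i.
  by rewrite KE; apply: sumr_ge0 => j _; exact: normr_ge0.
have mass : s + \sum_j A j <= D + e := mass_le D0 T_le g1 g0 gs.
have A_le i : A i <= D + e.
  by move: (K0 i) mass; rewrite /K; lra.
have d1 i : a i <= 1 := b_le1 S_le M (Omega, i).
have cd i : c i * d i <= a i * A i.
  by rewrite mulrC /a /A -normrM ler_norm.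
(* These signs make sigma * d i equal to c i * d i - `|d i| * K i. *)
pose th i j : R := if j == i then 1 else - Num.sg (c j * d i).
have th1 i j : `|th i j| <= 1.
  rewrite /th; case: eqP => _; first by rewrite normr1.
  by rewrite normrN normr_sg lern1; case: (c j * d i != 0).
have sigma i : (\sum_j th i j * c j) * d i = c i * d i - a i * K i.
  rewrite mulr_suml (bigD1 i)//= /th eqxx mul1r; congr (_ + _).
  rewrite KE mulr_sumr -sumrN.
  apply: eq_bigr => j /negPf ->; rewrite -mulrA mulNr -normrEsg.
  by rewrite normrM mulrC.
have thi i : th i i = 1 by rewrite /th eqxx.
have core : s + \sum_j a j * A j < 1 - 1 / 1000.
  apply: profile_lt => // [i|i||i|i].
  - exact: normr_ge0.
  - by rewrite normr_ge0 d1.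
  - by move: mass; rewrite /e /D; lra.
  - have := limit_constraint TK D0 e0 T_le S_le M_step (th1 i) i.
    rewrite -/(d i) -/c -/(a i) sigma thi => lc.
    by move: lc (cd i); rewrite -/(K i) /D /e; lra.
  - have [] :=
      spike_constraint TK D0 e0 T_le S_le g1 g0 gs M_step M_g (th1 i) i.
    rewrite -/c -/(d i) sigma thi -/(c i) -/(K i) => E0 sc.
    have q0 : 0 <= a i * K i by rewrite mulr_ge0 ?normr_ge0.
    have yA : a i * A i <= D + e.
      by apply: le_trans (A_le i); rewrite ler_piMl ?normr_ge0.
    have E_le : D - s - K i + 5 * e <= D + 5 * e by move: (K0 i) s0; lra.
    have -> : D - s - K i = (D - s - K i + 5 * e) - 5 * e by ring.
    by apply: (absorb_error q0 (cd i) yA _ sc); rewrite E0.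
have := pairing_ge SK D0 e0 T_le S_le M g1 g0 gs s_ub.
have : \sum_j c j * d j <= \sum_j a j * A j by apply: ler_sum => j _; exact: cd.
by rewrite -/c /e /D; move: core; lra.
Qed.

End lower_bound.

Section operator_norm.
Variables (R : realType) (V W : normedModType R) (T : {linear V -> W}).
Hypothesis T_bounded : bounded_near T (nbhs 0).

Lemma operator_norm_le v : `|T v| <= operator_norm T * `|v|.
Proof.
have [r [r0 Tr]] := pinfty_ex_gt0 ((linear_boundedP T).1 T_bounded).
have [->|v0] := eqVneq v 0; first by rewrite linear0 !normr0 mulr0.
have nv : 0 < `|v| by rewrite normr_gt0.
rewrite -ler_pdivrMr// mulrC.
have -> : `|v|^-1 * `|T v| = `|T (`|v|^-1 *: v)|.
  by rewrite linearZ normrZ gtr0_norm ?invr_gt0.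
apply: ub_le_sup; last first.
  exists (`|v|^-1 *: v) => //=.
  by rewrite normrZ gtr0_norm ?invr_gt0// mulVf// gt_eqF.
exists r => _ [x /= x1 <-]; apply: le_trans (Tr x) _.
by rewrite ler_piMr// ltW.
Qed.

Lemma operator_norm_ge0 : 0 <= operator_norm T.
Proof.
have [r [r0 Tr]] := pinfty_ex_gt0 ((linear_boundedP T).1 T_bounded).
apply: ub_le_sup; last by exists 0; rewrite /= ?linear0 ?normr0.
exists r => _ [x /= x1 <-]; apply: le_trans (Tr x) _.
by rewrite ler_piMr// ltW.
Qed.
End operator_norm.

Lemma distortion_ge (R : realType)
    (T : {linear continuous_space R three -> continuous_space R omega_succ})
    (S : {linear continuous_space R omega_succ -> continuous_space R three}) :
  inverse_isomorphisms T S -> 113 / 32 <= operator_norm T * operator_norm S.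
Proof.
move=> [TK SK bT bS]; rewrite leNgt; apply/negP => lt.
have T_le := operator_norm_le bT; have S_le := operator_norm_le bS.
have A0 := operator_norm_ge0 bT; have B0 := operator_norm_ge0 bS.
set A := operator_norm T in lt T_le A0; set B := operator_norm S in lt S_le B0.
have Bgt : 0 < B.
  rewrite lt0r B0 andbT; apply/eqP => BE.
  have := le_norm_pointwise (tail_indicator R 0) Omega.
  rewrite -[in leRHS](SK (tail_indicator R 0)) tail_indicatorE normr1.
  have -> : S (tail_indicator R 0) = 0.
    apply/normr0_eq0/eqP; rewrite eq_le normr_ge0 andbT.
    by have := S_le (tail_indicator R 0); rewrite BE mul0r.
  by rewrite linear0 normr0 ler10.
have Bn : B != 0 by rewrite gt_eqF.
apply: (@no_close_isomorphism _ (B \*: T) (B^-1 \*: S)).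
- by move=> f /=; rewrite linearZ scalerA mulVf// scale1r TK.
- by move=> y /=; rewrite linearZ scalerA divff// scale1r SK.
- move=> f /=; rewrite normrZ gtr0_norm//.
  apply: le_trans (_ : B * (A * `|f|) <= _).
    by apply: ler_wpM2l => //; exact: T_le.
  by rewrite mulrA ler_wpM2r// mulrC ltW.
- move=> y /=; rewrite normrZ gtr0_norm ?invr_gt0// ler_pdivrMl//.
  exact: S_le.
Qed.

(** * An isomorphism *)

Section interlacing.
Variable R : realType.
Local Notation X := (continuous_space R three).
Local Notation Y := (continuous_space R omega_succ).

(** The value f (n, i) is stored at 3 n + i + 2, shifted so that all three
    copies tend to the limit of the last one; the positions 0 and 1 store the
    two other limits. *)
Definition interlace (f : X) (x : omega_succ) : R :=
  let o2 : 'I_3 := inord 2 in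
  match x with
  | Omega => f (Omega, o2)
  | Fin 0 => f (Omega, inord 0)
  | Fin 1 => f (Omega, inord 1)
  | Fin k.+2 => f (Fin (k %/ 3), inord (k %% 3)) - f (Omega, inord (k %% 3))
      + f (Omega, o2)
  end.

Definition limit_value (y : Y) (i : 'I_3) : R :=
  if nat_of_ord i is 0 then y (Fin 0)
  else if nat_of_ord i is 1 then y (Fin 1) else y Omega.

Definition separate (y : Y) (p : three) : R :=
  if p.1 is Fin n then
    y (Fin (3 * n + nat_of_ord (p.2 : 'I_3)).+2) - y Omega + limit_value y p.2
  else limit_value y p.2.

Lemma interlace_continuous f : continuous (interlace f).
Proof.
apply: omega_succ_continuous => e e0.
have [n nP] := cts_three_cvg f e0.
exists (3 * n + 2)%N => -[|[|k]]; rewrite addn2 ?ltnS // => nk.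
have := nP (k %/ 3)%N (inord (k %% 3)); rewrite /interlace.
have nk' : (n <= k %/ 3)%N.
  by rewrite leq_divRL// mulnC; move: nk.
move=> /(_ nk'); apply: le_lt_trans; rewrite le_eqVlt.
by apply/orP; left; apply/eqP; congr (`|_|); ring.
Qed.

Lemma separate_continuous y : continuous (separate y).
Proof.
apply: three_continuous => i; apply: omega_succ_continuous => e e0.
have [n nP] := cts_omega_succ_cvg y e0.
exists n => m nm; rewrite /separate /=.
have := nP (3 * m + nat_of_ord i).+2.
have nm' : (n <= (3 * m + nat_of_ord i).+2)%N.
  apply: leq_trans nm _; apply: leqW; apply: leqW.
  by apply: leq_trans (leq_addr _ _); rewrite leq_pmull.
move=> /(_ nm'); apply: le_lt_trans; rewrite le_eqVlt.
by apply/orP; left; apply/eqP; congr (`|_|); ring.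
Qed.

Definition interlace_cts f : Y := mkcts (@interlace_continuous f).
Definition separate_cts y : X := mkcts (@separate_continuous y).

Lemma interlace_ctsE f x : interlace_cts f x = interlace f x.
Proof. by []. Qed.

Lemma separate_ctsE y p : separate_cts y p = separate y p.
Proof. by []. Qed.

Lemma interlace_linear : linear interlace_cts.
Proof.
move=> a f g; apply: cts_eqP => x; rewrite cts_addE cts_scaleE !interlace_ctsE.
by case: x => [[|[|k]]|]; rewrite /interlace !(cts_addE, cts_scaleE) //; ring.
Qed.

Lemma separate_linear : linear separate_cts.
Proof.
move=> a y y'; apply: cts_eqP => -[x i].
rewrite cts_addE cts_scaleE !separate_ctsE.
rewrite /separate /limit_value /=.
by case: x => [n|]; case: (nat_of_ord i) => [|[|k]];
  rewrite !(cts_addE, cts_scaleE) //; ring.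
Qed.

HB.instance Definition _ :=
  GRing.isLinear.Build R X Y _ interlace_cts interlace_linear.
HB.instance Definition _ :=
  GRing.isLinear.Build R Y X _ separate_cts separate_linear.

Lemma limit_value_interlace f i :
  limit_value (interlace_cts f) i = f (Omega, i).
Proof.
rewrite /limit_value; case: i => -[|[|[|//]]] hi /=; congr (f (_, _));
  by apply: val_inj; rewrite /= inordK.
Qed.

Lemma interlaceK : cancel interlace_cts separate_cts.
Proof.
move=> f; apply: cts_eqP => -[x i].
rewrite separate_ctsE /separate /= limit_value_interlace; case: x => [n|//].
have -> : interlace_cts f (Fin (3 * n + nat_of_ord i).+2) =
  f (Fin n, i) - f (Omega, i) + f (Omega, inord 2).
  have i3 : (nat_of_ord i < 3)%N := ltn_ord i.
  rewrite interlace_ctsE /interlace mulnC divnMDl// (divn_small i3) addn0.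
  by rewrite modnMDl (modn_small i3) inord_val.
by rewrite interlace_ctsE /interlace; ring.
Qed.

Lemma separateK : cancel separate_cts interlace_cts.
Proof.
move=> y; apply: cts_eqP => x.
have lim j : (separate_cts y) (Omega, j) = limit_value y j by [].
have lt2 : limit_value y (inord 2) = y Omega by rewrite /limit_value /= inordK.
rewrite interlace_ctsE /interlace; case: x => [[|[|k]]|]; rewrite ?lim.
- by rewrite /limit_value inordK.
- by rewrite /limit_value inordK.
- have -> : separate_cts y (Fin (k %/ 3), inord (k %% 3)) =
    y (Fin (3 * (k %/ 3) + nat_of_ord (inord (k %% 3) : 'I_3)).+2) - y Omega
      + limit_value y (inord (k %% 3)) by [].
  rewrite /= inordK ?ltn_mod// mulnC -divn_eq lt2; ring.
- exact: lt2.
Qed.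

Lemma bounded_of_pointwise (K L : compactType)
    (f : {linear continuous_space R K -> continuous_space R L}) (M : R) :
  0 <= M -> (forall u x, `|f u x| <= M * `|u|) -> bounded_near f (nbhs 0).
Proof.
move=> M0 fM; apply/linear_boundedP; exists M; split; first exact: num_real.
move=> r Mr u; apply: norm_le_pointwise.
  by rewrite mulr_ge0// (le_trans M0) ?ltW.
by move=> x; apply: le_trans (fM u x) _; rewrite ler_wpM2r// ltW.
Qed.

Lemma exists_isomorphism :
  inverse_isomorphisms
    (interlace_cts : {linear X -> Y}) (separate_cts : {linear Y -> X}).
Proof.
split; [exact: interlaceK|exact: separateK| |].
- apply: (@bounded_of_pointwise _ _ _ 3) => // f x.
  have b p : `|f p| <= `|f| := le_norm_pointwise f p.
  have -> : (interlace_cts : {linear X -> Y}) f x = interlace f x by [].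
  rewrite /interlace; case: x => [[|[|k]]|].
  + by have := b (Omega, inord 0); have := normr_ge0 f; lra.
  + by have := b (Omega, inord 1); have := normr_ge0 f; lra.
  + apply: le_trans (ler_normD _ _) _.
    have := ler_normB (f (Fin (k %/ 3), inord (k %% 3)))
      (f (Omega, inord (k %% 3))).
    have := b (Fin (k %/ 3), inord (k %% 3)); have := b (Omega, inord (k %% 3)).
    by have := b (Omega, inord 2); lra.
  + by have := b (Omega, inord 2); have := normr_ge0 f; lra.
- apply: (@bounded_of_pointwise _ _ _ 3) => // y [x i].
  have b p : `|y p| <= `|y| := le_norm_pointwise y p.
  have -> : (separate_cts : {linear Y -> X}) y (x, i) = separate y (x, i) by [].
  have l : `|limit_value y i| <= `|y|.
    by rewrite /limit_value; case: (nat_of_ord i) => [|[|k]].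
  rewrite /separate /=; case: x => [n|].
    apply: le_trans (ler_normD _ _) _.
    have := ler_normB (y (Fin (3 * n + i).+2)) (y Omega).
    by have := b (Fin (3 * n + i).+2); have := b Omega; lra.
  by have := normr_ge0 y; lra.
Qed.

End interlacing.

(* 113 / 32 = 3.53125 *)
Theorem theorem6p1 (R : realType) :
  113 / 32 <=
    banach_mazur_distance
      (continuous_space R (omega_succ * discrete_topology 'I_3)%type)
      (continuous_space R omega_succ).
Proof.
apply: lb_le_inf => [|_ [T [S [TS ->]]]]; last exact: distortion_ge.
by eexists; do 2 eexists; split; [exact: exists_isomorphism|reflexivity].
Qed.
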